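(* Let $X$ be a Banach space. If $X$ contains a complemented subspace isomorphic to $\ell_1$, then $X$ does not have property CWO-$B$.
   Context: Banach spaces are over the scalar field $\mathbb K$, where $\mathbb K=\mathbb R$ or $\mathbb K=\mathbb C$. $B_X$ and $B_X^\circ$ denote the closed and the open unit ball of $X$. A finite convex combination of relatively weakly open subsets of $B_X$ is a set $C=\sum_{j=1}^n\lambda_jU_j=\{\sum_{j=1}^n\lambda_ju_j: u_j\in U_j\}$, where $n\in\mathbb N$, each $U_j\subset B_X$ is open in the relative weak topology of $B_X$, $\lambda_j>0$ and $\sum_{j=1}^n\lambda_j=1$. The space $X$ has property CWO-$B$ if, for every such $C$, every $x\in C\cap B_X^\circ$ is an interior point of $C$ in the relative weak topology of $B_X$. *)

(* Defs.v *)
From HB Require Import structures.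
From mathcomp Require Import all_boot all_order all_algebra.
From mathcomp Require Import all_classical all_reals all_analysis.
From mathcomp Require Import complex.

Set Implicit Arguments.
Unset Strict Implicit.
Unset Printing Implicit Defensive.

Import Order.TTheory GRing.Theory Num.Theory.
Import numFieldNormedType.Exports.

Local Open Scope classical_set_scope.
Local Open Scope ring_scope.

(* K is meant to be a realType R or R[i]; the norm of a normedModType K is
   K-valued, with values in the nonnegative reals of K. *)

Section WeakTopology.
Context {K : numFieldType} (X : normedModType K).

Definition dual : Type := {f : {linear X -> K^o} | continuous f}.

Definition dual_topology (f : dual) : Topological X :=
  Topological.class (initial_topology (sval f : X -> K^o)).

Definition weak : topologicalType := sup_topology dual_topology.

Definition unit_ball : set X := [set x | `|x| <= 1].

(* [subspace A] is a topology on the whole carrier: it is the relative topology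
   on A, and the points outside A are isolated. *)
Definition weak_ball : topologicalType := subspace (unit_ball : set weak).

End WeakTopology.
Arguments unit_ball {K} X.

Section CWO.
Context {K : numFieldType} (X : normedModType K).

Definition convex_comb n (lam : 'I_n -> K) (U : 'I_n -> set X) : set X :=
  [set x | exists2 u : 'I_n -> X,
     (forall j, U j (u j)) & x = \sum_(j < n) lam j *: u j].

Definition CWO_B : Prop :=
  forall n (lam : 'I_n -> K) (U : 'I_n -> set X),
    (forall j, 0 < lam j) -> \sum_(j < n) lam j = 1 ->
    (forall j, U j `<=` unit_ball X) ->
    (forall j, open (U j : set (weak_ball X))) ->
    forall x : X, convex_comb lam U x -> `|x| < 1 ->
      (convex_comb lam U : set (weak_ball X))° x.

End CWO.

Section EllOne.
Context {K : numFieldType}.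

Definition ell1 : set (nat -> K^o) := [set a | cvgn ([normed series a] : nat -> K^o)].

Definition ell1_norm (a : nat -> K^o) : K := limn ([normed series a] : nat -> K^o).

Context (X : normedModType K).

(* T is a linear isomorphism of normed spaces from ell1 onto Y; its values
   outside ell1 are irrelevant. *)
Definition ell1_isomorphism (Y : set X) (T : (nat -> K^o) -> X) : Prop :=
  [/\ (forall (c : K) (a b : nat -> K^o), ell1 a -> ell1 b ->
         T (fun i => c * a i + b i) = c *: T a + T b),
      set_bij ell1 Y T,
      (exists2 C : K, 0 < C & forall a, ell1 a -> `|T a| <= C * ell1_norm a) &
      (exists2 c : K, 0 < c & forall a, ell1 a -> ell1_norm a <= c * `|T a|)].

Definition complemented (Y : set X) : Prop :=
  exists P : {linear X -> X},
    [/\ continuous P, (forall x, P (P x) = P x) & range P = Y].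

Definition contains_complemented_ell1 : Prop :=
  exists Y : set X, complemented Y /\ exists T, ell1_isomorphism Y T.

End EllOne.

(* Main.v *)
From HB Require Import structures.
Require Import Defs.
From mathcomp Require Import all_boot all_order all_algebra.
From mathcomp Require Import all_classical all_reals all_analysis.
From mathcomp Require Import complex ring.
Import numFieldNormedType.Exports.
Local Open Scope ring_scope.
Set Implicit Arguments.
Unset Strict Implicit.
Unset Printing Implicit Defensive.
Import Order.TTheory GRing.Theory Num.Theory.
Local Open Scope classical_set_scope.

(** Write [e_i] for the vectors of [X] that correspond to the unit vectors of
    ell1, and [f_i] for the coordinate functionals composed with the projection.
    The seminorm [S x = \sum_i `|f_i x|] is finite and bounded on the unit ball,
    and it has two features of ell1 that survive any renorming and any
    complement.

    - Every weak neighbourhood of 0 contains unit vectors [x] with [S x >= 1/c],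
      whose first [N] coordinates vanish: finitely many functionals have a common
      zero in the span of sufficiently many vectors [e_N, e_N.+1, ...]
      (l1_system_weak_null).
    - Coordinates of small and large index contribute separately to [S].

    Let [u] be in the unit ball, and choose [N] such that the first [N]
    coordinates carry almost all of [S u].  Let [U] and [V] be the weakly open
    sets of the points of the ball whose first [N] coordinates are close to those
    of [u] and of [-u].  Then [0 = (u + (-u)) / 2] lies in [(U + V) / 2].  If it
    were an interior point, then some [x] as above would be [(y + z) / 2] with
    [y] in [U] and [z] in [V].  The first coordinates of [y] and of [z] both carry
    almost [S u], and the tails of [y] and [z] together carry at least
    [2 * S x >= 2 / c].  Hence [y] or [z] satisfies [S >= S u + 1/(2c)]
    (partial_l1_grow).  So no point of the ball comes near the supremum of [S];
    iterating from 0 makes [S] unbounded on the ball, which is absurd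
    (l1_system_not_CWO_B).

    Suprema and infinite sums are avoided by working with partial sums of [S], so
    that the argument runs over any numFieldType.  The scalars enter only through
    bounded_monotone_cvg, which makes ell1 closed under linear combinations and
    the scalars archimedean. *)

(** * Weak neighbourhoods *)

Lemma weak_continuous (K : numFieldType) (X : normedModType K)
    (g : {linear X -> K^o}) :
  continuous g -> continuous (g : weak X -> K^o).
Proof.
move=> gc x.
have /cvg_sup/(_ (exist _ g gc)) cx : (nbhs (x : weak X)) --> (x : weak X) by exact: cvg_id.
move=> A /(@initial_continuous _ _ (g : X -> K^o) x) h.
exact: cx.
Qed.

(** The sets that contain a finite intersection of kernels form a filter which
    converges to 0 for every functional, hence weakly; this converts the abstract
    supremum topology into linear algebra. *)
Lemma weak_nbhs0 (K : numFieldType) (X : normedModType K) (W : set X) :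
  nbhs (0 : weak X) W ->
  exists gs : seq {linear X -> K^o},
    forall x : X, (forall g, g \in gs -> g x = 0) -> W x.
Proof.
pose F : set_system X := [set V | exists gs : seq {linear X -> K^o},
  forall x : X, (forall g, g \in gs -> g x = 0) -> V x].
have FF : Filter F.
  split.
  - by exists [::].
  - move=> P Q [s sP] [t tQ]; exists (s ++ t) => x st0; split.
      by apply: sP => g gs; apply: st0; rewrite mem_cat gs.
    by apply: tQ => g gt; apply: st0; rewrite mem_cat gt orbT.
  - by move=> P Q PQ [s sP]; exists s => x /sP /PQ.
suff FW : F --> (0 : weak X) by exact: FW.
apply/cvg_sup => -[g gc] V [B [[U Uo <-] /= B0 BV]].
exists [:: g] => x x0; apply: BV.
by rewrite /= (x0 g) ?mem_head// -[0](linear0 g).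
Qed.

(** One more vector than there are functionals: the matrix of their values has a
    nonzero left kernel. *)
Lemma common_kernel_combination (K : fieldType) (V : lmodType K)
    (gs : seq {linear V -> K^o}) (e : nat -> V) :
  exists2 r : 'I_(size gs).+1 -> K, (exists i, r i != 0) &
    forall g, g \in gs -> g (\sum_i r i *: e i) = 0.
Proof.
pose G := \matrix_(i < (size gs).+1, j < size gs) (tnth (in_tuple gs) j (e i) : K).
have : kermx G != 0.
  by rewrite -mxrank_eq0 mxrank_ker subn_eq0 -ltnNge ltnS rank_leq_col.
case/rowV0Pn => v /sub_kermxP vG v0.
exists (fun i => v 0 i).
  by move/rV0Pn: v0 => [i vi]; exists i.
move=> g /(tnthP (in_tuple gs)) [j ->].
have := congr1 (fun A : 'rV__ => A 0 j) vG; rewrite !mxE => <-.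
by rewrite linear_sum; apply: eq_bigr => i _; rewrite linearZ !mxE.
Qed.

(** * Biorthogonal systems equivalent to the basis of ell1 *)

Section BiorthogonalSystem.
Context {K : numFieldType} (X : normedModType K).

Definition partial_l1 (f : nat -> X -> K) (N : nat) (x : X) : K :=
  \sum_(i < N) `|f i x|.

Lemma partial_l1_ge0 f N x : 0 <= partial_l1 f N x.
Proof. exact: sumr_ge0. Qed.

Lemma partial_l1_tail f N m x : (forall i, (i < N)%N -> f i x = 0) ->
  partial_l1 f (N + m) x = \sum_(i < m) `|f (N + i)%N x|.
Proof.
move=> f0; rewrite /partial_l1 big_split_ord /= big1 ?add0r// => i _.
by rewrite f0 // normr0.
Qed.

(** This is all that is used of a complemented copy of ell1.  The bound on [e]
    gives [`|\sum_i r_i e_i| <= c * \sum_i `|r_i|], and the last inequality says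
    that [x |-> (f_i x)_i] is a bounded operator into ell1. *)
Record l1_system (e : nat -> X) (f : nat -> {linear X -> K^o}) (c M : K) :
    Prop := L1System {
  l1_continuous : forall i, continuous (f i);
  l1_dual : forall i j, f i (e j) = (i == j)%:R;
  l1_vec_bound : forall i, `|e i| <= c;
  l1_sum_bound : forall N x, partial_l1 f N x <= M * `|x|;
  l1_lower_gt0 : 0 < c;
  l1_upper_ge0 : 0 <= M }.

(** A combination of [e_N, e_N.+1, ...] killed by the functionals that determine
    [W] is nonzero, so it can be normalized; since the [e_i] are bounded, a unit
    vector cannot have small coordinates. *)
Lemma l1_system_weak_null e f c M (W : set X) (N : nat) :
  l1_system e f c M -> nbhs (0 : weak X) W ->
  exists x m, [/\ W x, `|x| = 1, forall i, (i < N)%N -> f i x = 0 &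
    c^-1 <= partial_l1 f (N + m) x].
Proof.
move=> [fc fe ec _ c0 _] /weak_nbhs0 [gs gsW].
have [r [i0 ri0] rgs] := common_kernel_combination gs (fun i => e (N + i)%N).
set y := \sum_i _ in rgs; pose m := (size gs).+1.
have fy i : (i < N)%N -> f i y = 0.
  move=> iN; rewrite linear_sum big1// => j _; rewrite linearZ /= fe.
  by rewrite [i == _]ltn_eqF ?scaler0// (leq_trans iN)// leq_addr.
have fyN (j : 'I_m) : f (N + j)%N y = r j.
  rewrite linear_sum (bigD1 j)//= big1 ?addr0 => [|k kj].
    by rewrite linearZ /= fe eqxx [_ *: _]mulr1.
  by rewrite linearZ /= fe eqn_add2l eq_sym val_eqE (negbTE kj) scaler0.
have y0 : y != 0 by apply: contra_neq ri0 => y0; rewrite -fyN y0 linear0.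
have ny : 0 < `|y| by rewrite normr_gt0.
exists (`|y|^-1 *: y), m; split.
- by apply: gsW => g /rgs gy; rewrite linearZ /= gy scaler0.
- by rewrite normrZ ger0_norm ?invr_ge0// mulVf// gt_eqF.
- by move=> i iN; rewrite linearZ /= fy// scaler0.
rewrite partial_l1_tail; last first.
  by move=> i iN; rewrite linearZ /= fy// scaler0.
under eq_bigr do rewrite linearZ /= fyN normrM ger0_norm ?invr_ge0//.
rewrite -mulr_sumr ler_pdivlMl// ler_pdivrMr//.
rewrite (le_trans (ler_norm_sum _ _ _))// mulr_suml ler_sum// => i _.
by rewrite normrZ ler_wpM2l.
Qed.

(** In the relative topology of the ball the ball itself is open, so that only the
    finitely many coordinate conditions matter. *)
Lemma weak_open_tube (f : nat -> {linear X -> K^o}) (N : nat) (u : X) (d : K) :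
  (forall i, continuous (f i)) ->
  open ([set y | unit_ball X y /\ forall i, (i < N)%N -> `|f i (y - u)| < d]
        : set (weak_ball X)).
Proof.
move=> fc.
apply: (@openI (weak_ball X) (unit_ball X)
  [set y : X | forall i, (i < N)%N -> `|f i (y - u)| < d]).
  exact: open_subspaceT.
apply: open_subspaceW.
elim: N => [|N IH].
  suff -> : [set y : X | forall i, (i < 0)%N -> `|f i (y - u)| < d] = setT.
    exact: (@openT (weak X)).
  by rewrite -subTset => x _ i.
have -> : [set y : X | forall i, (i < N.+1)%N -> `|f i (y - u)| < d] =
    [set y : X | forall i, (i < N)%N -> `|f i (y - u)| < d] `&`
    (f N : X -> K^o) @^-1` ball (f N u : K^o) d.
  apply/seteqP; split => y /=; rewrite -ball_normE /ball_ /= distrC -linearB.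
    by move=> h; split=> [i iN|]; [exact/h/ltnW | exact: h].
  move=> [h1 h2] i; rewrite ltnS leq_eqVlt => /orP[/eqP->//|].
  exact: h1.
apply: (@openI (weak X)) => //.
apply: (@open_comp (weak X) K^o); last exact: ball_open.
by move=> y _; exact: weak_continuous.
Qed.

End BiorthogonalSystem.

(** * Growth of the ell1 mass *)

Section Growth.
Context {K : numFieldType} (X : normedModType K).

Lemma partial_l1_split (f : nat -> X -> K) N m x :
  partial_l1 f (N + m) x = partial_l1 f N x + \sum_(i < m) `|f (N + i)%N x|.
Proof. by rewrite /partial_l1 big_split_ord. Qed.

Lemma partial_l1_near (f : nat -> {linear X -> K^o}) N (u y : X) (d : K) :
  (forall i, (i < N)%N -> `|f i (y - u)| < d) ->
  partial_l1 f N u <= partial_l1 f N y + d *+ N.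
Proof.
move=> fd; rewrite -[in d *+ N](card_ord N) -sumr_const -big_split /=.
apply: ler_sum => i _; rewrite -lerBlDl.
apply: le_trans (ltW (fd i _)) => //.
rewrite linearB distrC; apply: le_trans (lerB_dist _ _) _; exact: lexx.
Qed.

Lemma partial_l1N (f : nat -> {linear X -> K^o}) N (u : X) :
  partial_l1 f N (- u) = partial_l1 f N u.
Proof. by apply: eq_bigr => i _; rewrite linearN normrN. Qed.

(** Convex combinations of neighbourhoods of [u] and [-u] contain 0.  Their other
    points are midpoints of vectors whose first coordinates resemble those of [u]
    up to sign, while the tail of the midpoint bounds the sum of the two tails
    from below. *)
Lemma partial_l1_grow (e : nat -> X) (f : nat -> {linear X -> K^o}) (c M : K)
    (N : nat) (u : X) :
  CWO_B X -> l1_system e f c M -> `|u| <= 1 ->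
  exists y N', `|y| <= 1 /\ partial_l1 f N u + c^-1 / 2 <= partial_l1 f N' y.
Proof.
move=> cwo sys u1; have [fc _ _ _ c0 _] := sys.
(* The error [d] is made in each of [N] coordinates, and must use up at most half
   of the gain [c^-1]. *)
pose d := c^-1 / 2 / N.+1%:R.
have d0 : 0 < d by rewrite !divr_gt0 ?invr_gt0.
have dN : d *+ N <= c^-1 / 2.
  rewrite -[leRHS](@divfK _ N.+1%:R) ?pnatr_eq0// -/d mulr_natr.
  by rewrite ler_pMn2l.
(* The two centres [s j *: u] are [u] and [-u]. *)
pose s (j : 'I_2) : K := (-1) ^+ j.
pose U (j : 'I_2) : set X := [set y | unit_ball X y /\
  forall i, (i < N)%N -> `|f i (y - s j *: u)| < d].
pose C := convex_comb (fun=> 2^-1) U.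
have intC : (C : set (weak_ball X))° (0 : X).
  apply: cwo => //.
  - by rewrite sumr_const card_ord -[LHS]mulr_natr mulVf// pnatr_eq0.
  - by move=> j y [].
  - by move=> j; exact: weak_open_tube.
  - exists (fun j => s j *: u).
      move=> j; split=> [|i iN]; last by rewrite subrr linear0 normr0.
      by rewrite /unit_ball /= normrZ normrX normrN1 expr1n mul1r.
    rewrite -scaler_sumr -scaler_suml /s !big_ord_recl big_ord0 /=.
    by rewrite expr0 expr1 addr0 subrr scale0r scaler0.
  - by rewrite normr0.
have B0 : unit_ball X 0 by rewrite /unit_ball /= normr0.
have WC : within (unit_ball X : set (weak X)) (nbhs (0 : weak X)) C.
  by rewrite nbhs_subspace_in.
have [x [m [Wx x1 fx sx]]] := l1_system_weak_null N sys WC.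
have [w Uw xE] : C x by apply: Wx; rewrite /unit_ball /= x1.
rewrite !big_ord_recl big_ord0 addr0 in xE.
set y := w ord0 in xE; set z := w _ in xE.
have [y1 yu] : U ord0 y by exact: Uw.
have [z1 zu] := Uw _ : U (lift ord0 ord0) z.
rewrite /s /= expr0 scale1r in yu; rewrite /s /= expr1 scaleN1r in zu.
have hy := partial_l1_near yu; have := partial_l1_near zu.
rewrite partial_l1N => hz.
(* The first [N] coordinates of [x = (y + z) / 2] vanish, so all its mass sits in
   the tail. *)
have tail : c^-1 *+ 2 <= \sum_(i < m) `|f (N + i)%N y| +
                         \sum_(i < m) `|f (N + i)%N z|.
  rewrite partial_l1_tail// in sx.
  rewrite -[leLHS]mulr_natr -ler_pdivlMr// (le_trans sx)// -big_split mulr_suml /=.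
  apply: ler_sum => i _; rewrite xE -scalerDr linearZ linearD normrM.
  by rewrite ger0_norm ?invr_ge0// mulrC ler_wpM2r ?invr_ge0// ler_normD.
have total : (partial_l1 f N u + c^-1 / 2) *+ 2 <=
    partial_l1 f (N + m) y + partial_l1 f (N + m) z.
  rewrite !partial_l1_split addrACA.
  have h := lerD (lerD hy hz) tail.
  have -> : (partial_l1 f N u + c^-1 / 2) *+ 2 =
      partial_l1 f N u + partial_l1 f N u + c^-1 *+ 2 - (c^-1 / 2 + c^-1 / 2).
    by rewrite -splitr mulrnDl -(mulr_natr (_ / 2)) divfK ?pnatr_eq0// !mulr2n; ring.
  rewrite lerBlDr (le_trans h)// [X in X + _ <= _]addrACA [leLHS]addrAC lerD2l lerD//.
have g0 : 0 <= partial_l1 f N u + c^-1 / 2.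
  by rewrite addr_ge0 ?partial_l1_ge0// divr_ge0// invr_ge0 ltW.
have [yle|ylt] := real_leP (ger0_real g0) (ger0_real (partial_l1_ge0 f (N + m) y)).
  by exists y, (N + m)%N.
exists z, (N + m)%N; split=> //.
rewrite -(lerD2l (partial_l1 f (N + m) y)) (le_trans _ total)//.
by rewrite mulr2n lerD2r ltW.
Qed.

(** Each step gains the same amount [c^-1 / 2], so the partial sums would be
    unbounded on the ball. *)
Lemma l1_system_not_CWO_B (e : nat -> X) (f : nat -> {linear X -> K^o})
    (c M : K) :
  (forall B : K, exists n : nat, ~ n%:R <= B) ->
  l1_system e f c M -> ~ CWO_B X.
Proof.
move=> arch sys cwo; have [_ _ _ _ c0 M0] := sys.
have steps k : exists u N, `|u| <= 1 /\ k%:R * (c^-1 / 2) <= partial_l1 f N u.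
  elim: k => [|k [u [N [u1 ku]]]].
    by exists 0, 0%N; rewrite normr0 mul0r; split=> //; exact: partial_l1_ge0.
  have [y [N' [y1 uy]]] := partial_l1_grow N cwo sys u1.
  exists y, N'; split=> //; apply: le_trans uy.
  by rewrite mulrS mulrDl mul1r addrC lerD2r.
have [k] := arch (M / (c^-1 / 2)); apply.
have [u [N [u1 ku]]] := steps k.
rewrite ler_pdivlMr ?divr_gt0 ?invr_gt0//.
apply: le_trans ku _; apply: le_trans (l1_sum_bound sys N u) _.
by rewrite -[leRHS]mulr1 ler_wpM2l.
Qed.

End Growth.

(** * Extraction of the biorthogonal system *)

(** The form of completeness of the scalars that holds over the real and the
    complex numbers alike: the order on complex numbers only compares numbers with
    equal imaginary parts. *)
Definition bounded_monotone_cvg (K : numFieldType) : Prop :=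
  forall (u : nat -> K^o) (B : K), (forall n, 0 <= (u n : K)) ->
    {homo u : n m / (n <= m)%N >-> (n : K) <= m} ->
    (forall n, (u n : K) <= B) -> cvgn u.

Section EllOneFacts.
Context {K : numFieldType}.

(** The order of a numFieldType need not be total, so [u n <= L] is proved as
    [L - u n] being equal to its own norm: it is a limit of the nonnegative
    differences [u m - u n]. *)
Lemma nondecreasing_le_lim (u : nat -> K^o) (L : K) :
  {homo u : n m / (n <= m)%N >-> (n : K) <= m} -> u n @[n --> \oo] --> (L : K^o) ->
  forall n, (u n : K) <= L.
Proof.
move=> umono /cvgrPdist_lt uL n; rewrite -subr_ge0.
apply/normr_idP/eqP; rewrite -subr_eq0.
apply/negPn/negP; rewrite -normr_gt0 => w0.
have := uL _ (divr_gt0 w0 (ltr0Sn _ 1)); case=> N _ uN.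
have := uN (maxn n N) (leq_maxr _ _) => /= h.
pose d := u (maxn n N) - u n.
have d0 : 0 <= d by rewrite subr_ge0 umono// leq_maxl.
suff : `| `|L - u n| - (L - u n)| < `| `|L - u n| - (L - u n)| by rewrite ltxx.
have h1 : `|(L - u n) - d| < `| `|L - u n| - (L - u n)| / 2.
  by rewrite /d opprB addrA subrK.
rewrite [ltRHS]splitr.
apply: le_lt_trans (ltrD h1 h1); apply: le_trans (ler_distD d _ _) _.
rewrite [X in _ + X]distrC lerD2r -{1}(ger0_norm d0).
exact: ler_dist_dist.
Qed.

(** Otherwise the sequence of the natural numbers is bounded, hence convergent,
    although consecutive terms stay at distance 1. *)
Lemma bounded_monotone_archimedean : bounded_monotone_cvg K ->
  forall B : K, exists n : nat, ~ n%:R <= B.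
Proof.
move=> mono B; apply: contrapT => /forallNP nB.
have nmono : {homo (fun n => n%:R : K^o) : n m / (n <= m)%N >-> (n : K) <= m}.
  by move=> n m; rewrite ler_nat.
have /cvgrPdist_lt/(_ 2^-1) : cvgn (fun n => n%:R : K^o).
  by apply: (mono _ B) => // n; exact: contrapT.
rewrite invr_gt0 => /(_ (ltr0Sn _ 1)) [N _ hN].
have /= h1 := hN N (leqnn N); have /= h2 := hN N.+1 (leqnSn N).
have : `|N%:R - N.+1%:R : K| < 2^-1 + 2^-1.
  apply: le_lt_trans (ltrD h1 h2).
  by rewrite [X in _ <= X + _]distrC; exact: ler_distD.
by rewrite -natr1 opprD addNKr normrN1 -[2^-1]mul1r -splitr ltxx.
Qed.

Lemma normed_seriesE (a : nat -> K^o) n :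
  [normed series a] n = \sum_(i < n) `|a i : K|.
Proof. exact: big_mkord. Qed.

Lemma normed_series_ge0 (a : nat -> K^o) n : 0 <= ([normed series a] n : K).
Proof. by rewrite normed_seriesE sumr_ge0. Qed.

Lemma normed_series_homo (a : nat -> K^o) :
  {homo ([normed series a] : nat -> K^o) : n m / (n <= m)%N >-> (n : K) <= m}.
Proof.
move=> n m nm; have [k ->] : exists k, m = (n + k)%N by exists (m - n)%N; rewrite subnKC.
by rewrite !normed_seriesE big_split_ord /= lerDl sumr_ge0.
Qed.

Lemma partial_le_ell1_norm (a : nat -> K^o) n : ell1 a ->
  \sum_(i < n) `|a i : K| <= ell1_norm a.
Proof.
move=> a1; have := nondecreasing_le_lim (@normed_series_homo a) a1 n.
by rewrite normed_seriesE.
Qed.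

Lemma ell1_bounded : bounded_monotone_cvg K ->
  forall (a : nat -> K^o) (B : K), (forall n, \sum_(i < n) `|a i : K| <= B) ->
  ell1 a.
Proof.
move=> mono a B aB; apply: (mono _ B).
- exact: normed_series_ge0.
- exact: normed_series_homo.
- by move=> n; rewrite normed_seriesE; exact: aB.
Qed.

Lemma ell1_comb (c : K) (a b : nat -> K^o) : bounded_monotone_cvg K ->
  ell1 a -> ell1 b -> ell1 (fun i => c * a i + b i).
Proof.
move=> mono a1 b1.
apply: (ell1_bounded mono (B := `|c| * ell1_norm a + ell1_norm b)) => n.
apply: (@le_trans _ _ (`|c| * (\sum_(i < n) `|a i : K|) + \sum_(i < n) `|b i : K|)).
  rewrite mulr_sumr -big_split /=; apply: ler_sum => i _.
  by rewrite -normrM ler_normD.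
by rewrite lerD ?ler_wpM2l// partial_le_ell1_norm.
Qed.

Definition ell1_unit (j : nat) : nat -> K^o := fun i => (i == j)%:R.

Lemma ell1_unit_cvg j : ([normed series (ell1_unit j)] : nat -> K^o) @ \oo --> (1 : K^o).
Proof.
apply: cvg_near_cst; exists j.+1 => // n /= jn.
change ([normed series (ell1_unit j)] n = 1 :> K).
rewrite normed_seriesE (bigD1 (Ordinal jn))//= big1 ?addr0 => [|i].
  by rewrite /ell1_unit eqxx normr1.
by rewrite -val_eqE /= /ell1_unit => /negbTE ->; rewrite normr0.
Qed.

Lemma ell1_unit_ell1 j : ell1 (ell1_unit j).
Proof. by apply/cvg_ex; exists (1 : K^o); exact: ell1_unit_cvg. Qed.

Lemma ell1_unit_norm j : ell1_norm (ell1_unit j) = 1.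
Proof. exact: (cvg_lim (@norm_hausdorff _ _) (@ell1_unit_cvg j)). Qed.

Lemma linear_bound (X Y : normedModType K) (g : {linear X -> Y}) :
  continuous g -> exists2 r : K, 0 < r & forall x, `|g x| <= r * `|x|.
Proof.
move=> gc; have /linear_boundedP gb := continuous_linear_bounded 0 (gc 0).
near (+oo : set_system K) => r.
exists r; first by near: r; exact: nbhs_pinfty_gt.
by near: r.
Unshelve. all: by end_near. Qed.

Lemma bounded_continuous (X Y : normedModType K) (g : {linear X -> Y}) (M : K) :
  0 <= M -> (forall x, `|g x| <= M * `|x|) -> continuous g.
Proof.
move=> M0 gM; apply: bounded_linear_continuous; apply/linear_boundedP.
near=> r => x; apply: le_trans (gM x) _; rewrite ler_wpM2r//.
by near: r; apply: nbhs_pinfty_ge; exact: ger0_real.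
Unshelve. all: by end_near. Qed.

(** The functionals are the coordinates of the preimage of [P x] under the
    isomorphism [T].  That they are linear follows from the injectivity of [T] on
    ell1, which applies to a combination of preimages only because ell1 is closed
    under linear combinations. *)
Lemma complemented_ell1_system (X : normedModType K) :
  bounded_monotone_cvg K -> contains_complemented_ell1 X ->
  exists (e : nat -> X) (f : nat -> {linear X -> K^o}) (c M : K),
    l1_system e f c M.
Proof.
move=> mono [Y [[P [Pc PP PY]] [T [Tlin [TY Tinj Tsurj] [c c0 Tc] [c' c'0 Tc']]]]].
have /choice [A AP] x : exists a, ell1 a /\ T a = P x.
  have /Tsurj [a a1 Ta] : Y (P x) by rewrite -PY; exists x.
  by exists a.
have A1 x := (AP x).1; have TA x := (AP x).2.
have Auniq x a : ell1 a -> T a = P x -> A x = a.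
  by move=> a1 Ta; apply: Tinj; rewrite ?inE// TA Ta.
have Alin k x y : A (k *: x + y) = fun i => k * A x i + A y i.
  by apply: Auniq; [exact: ell1_comb | rewrite Tlin// !TA linearP].
have /choice [f fE] i : exists g : {linear X -> K^o}, forall x, g x = A x i.
  pose g : X -> K^o := fun x => A x i.
  have glin : linear g by move=> k x y; rewrite /g Alin.
  pose gL := GRing.isLinear.Build K X K^o *:%R g glin.
  by exists (HB.pack g gL : {linear X -> K^o}).
have [r r0 Pr] := linear_bound Pc.
have cr0 : 0 <= c' * r by rewrite mulr_ge0// ltW.
have fsum N x : partial_l1 f N x <= c' * r * `|x|.
  rewrite /partial_l1; under eq_bigr do rewrite fE.
  rewrite (le_trans (partial_le_ell1_norm N (A1 x)))//.
  rewrite (le_trans (Tc' _ (A1 x)))// -mulrA ler_wpM2l ?(ltW c'0)//.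
  by rewrite TA.
exists (fun j => T (ell1_unit j)), f, c, (c' * r); split=> //.
- move=> i; apply: (bounded_continuous cr0) => x.
  apply: le_trans (fsum i.+1 x); rewrite /partial_l1 big_ord_recr /= lerDr.
  exact: sumr_ge0.
- move=> i j; rewrite fE (Auniq _ (ell1_unit j))//; first exact: ell1_unit_ell1.
  have : Y (T (ell1_unit j)) by apply: TY; exact: ell1_unit_ell1.
  by rewrite -PY => -[x _ <-]; rewrite PP.
- move=> i; rewrite (le_trans (Tc _ (@ell1_unit_ell1 i)))//.
  by rewrite ell1_unit_norm mulr1.
Qed.

Lemma complemented_ell1_not_CWO_B (X : normedModType K) :
  bounded_monotone_cvg K -> contains_complemented_ell1 X -> ~ CWO_B X.
Proof.
move=> mono /(complemented_ell1_system mono) [e [f [c [M sys]]]].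
exact: l1_system_not_CWO_B (bounded_monotone_archimedean mono) sys.
Qed.

End EllOneFacts.

(** * The scalar fields *)

Lemma real_bounded_monotone_cvg (R : realType) : bounded_monotone_cvg R.
Proof.
move=> u B _ umono uB; apply: (@nondecreasing_is_cvgn R) => //.
by exists B => _ [n _ <-].
Qed.

(** A nonnegative complex number is real, so this is convergence of the real
    parts. *)
Lemma complex_bounded_monotone_cvg (R : realType) : bounded_monotone_cvg R[i].
Proof.
move=> u B u0 umono uB.
pose v n : R := complex.Re (u n).
have uE n : u n = (v n)%:C%C by have := u0 n; rewrite lecE /v => /andP[/eqP/=]; case: (u n) => a b /= ->.
have : cvgn v.
  apply: nondecreasing_is_cvgn => [n m nm|].
    by have := umono n m nm; rewrite lecE => /andP[].
  exists (complex.Re B) => _ [n _ <-].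
  by have := uB n; rewrite lecE => /andP[].
move=> /cvgrPdist_lt vl; apply/cvg_ex; exists ((limn v)%:C%C : R[i]^o).
apply/cvgrPdist_lt => eps; rewrite ltcE => /andP[/eqP/= eI eR].
have := vl _ eR; apply: filterS => n h.
rewrite uE -rmorphB normc_def/= expr0n addr0 sqrtr_sqr ltcE /=.
by rewrite eI eqxx.
Qed.

Theorem corollary4p5 (R : realType) :
  (forall X : completeNormedModType R,
     contains_complemented_ell1 X -> ~ CWO_B X) /\
  (forall X : completeNormedModType R[i],
     contains_complemented_ell1 X -> ~ CWO_B X).
Proof.
split=> X; apply: complemented_ell1_not_CWO_B.
  exact: real_bounded_monotone_cvg.
exact: complex_bounded_monotone_cvg.
Qed.
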